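(* Let $\mathbb{X}_{\mathrm{F}}$ be the $(\times2,\times3)$-shift with its Haar probability measure $\mu_{\mathrm{F}}$, let $n\in\mathbb{N}$ (with $n\ge1$), and let $z_1,\ldots,z_n$ be $n$ arbitrary points of $\mathbb{Z}^2$. Then, for $\mu_{\mathrm{F}}$-almost every $w\in\mathbb{X}_{\mathrm{F}}$, the $n$-point correlation exists and satisfies $$\langle z_1,\ldots,z_n\rangle_{\mathrm{F}}=0.$$ More generally, writing $z_j=k_j e_1+\ell_j e_2$ with $k_j,\ell_j\in\mathbb{Z}$, and for arbitrary $m_1,\ldots,m_n\in\mathbb{Z}$, for $\mu_{\mathrm{F}}$-almost every $w\in\mathbb{X}_{\mathrm{F}}$ the generalised correlation coefficient exists and satisfies $$\big\langle (z_1,m_1),\ldots,(z_n,m_n)\big\rangle_{\mathrm{F}}=\begin{cases}1,&\text{if }\sum_{j=1}^n m_j\,2^{k_j}\,3^{\ell_j}=0,\\ 0,&\text{otherwise.}\end{cases}$$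
   Context: Let $e_1,e_2$ be the standard unit vectors of $\mathbb{Z}^2$ and $\mathbb{S}^1=\{z\in\mathbb{C}\mid |z|=1\}$. The $(\times2,\times3)$-shift (written multiplicatively) is $$\mathbb{X}_{\mathrm{F}}=\{w\in(\mathbb{S}^1)^{\mathbb{Z}^2}\mid w_{z+e_1}=w_z^2,\ w_{z+e_2}=w_z^3\text{ for all }z\in\mathbb{Z}^2\},$$ a closed subgroup (under pointwise multiplication) of the compact Abelian group $(\mathbb{S}^1)^{\mathbb{Z}^2}$ with the product topology; $\mu_{\mathrm{F}}$ is its normalised Haar measure, which is invariant and ergodic for the $\mathbb{Z}^2$ shift action $(\alpha^z(w))_x=w_{x+z}$. Let $C_N=[-N,N]^2$. For $w\in\mathbb{X}_{\mathrm{F}}$, points $z_1,\ldots,z_n\in\mathbb{Z}^2$ and integers $m_1,\ldots,m_n\in\mathbb{Z}$, the generalised correlation coefficient is $$\big\langle (z_1,m_1),\ldots,(z_n,m_n)\big\rangle_{\mathrm{F}}=\lim_{N\to\infty}\frac{1}{|\mathbb{Z}^2\cap C_N|}\sum_{x\in\mathbb{Z}^2\cap C_N}\ \prod_{j=1}^n \big(w_{x+z_j}\big)^{m_j},$$ whenever the limit exists (it depends on $w$, which is suppressed in the notation). The $n$-point correlation is the case of all $m_j=1$: $\langle z_1,\ldots,z_n\rangle_{\mathrm{F}}=\langle (z_1,1),\ldots,(z_n,1)\rangle_{\mathrm{F}}$. *)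

(* Defs.v *)
From HB Require Import structures.
From mathcomp Require Import all_boot all_order all_algebra finmap.
From mathcomp Require Import all_classical all_reals all_analysis.
From mathcomp Require Import complex.
From mathcomp Require Import zify.

Set Implicit Arguments.
Unset Strict Implicit.
Unset Printing Implicit Defensive.

Import Order.TTheory GRing.Theory Num.Theory.
Import numFieldNormedType.Exports.

Local Open Scope classical_set_scope.
Local Open Scope ring_scope.

(* The library puts the topology of the modulus on the alias [R[i]^o] only. *)
HB.instance Definition _ (R : realType) :=
  PseudoPointedMetric.copy R[i] (R[i]^o).
HB.instance Definition _ (R : realType) := NormedModule.copy R[i] (R[i]^o).

Definition e1 : int * int := (1, 0).
Definition e2 : int * int := (0, 1).

Definition circle (R : realType) : set R[i] := [set u | `|u| = 1].

(* As a subset of the product space C^(Z^2); it lies in (S^1)^(Z^2), whose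
   product topology is the one induced from C^(Z^2). *)
Definition x2x3_shift (R : realType) : set {ptws int * int -> R[i]} :=
  [set w | (forall z, circle (w z)) /\
           (forall z, w (z + e1) = w z ^+ 2 /\ w (z + e2) = w z ^+ 3)].

Definition XF (R : realType) : Type := set_type (@x2x3_shift R).

HB.instance Definition _ (R : realType) :=
  Topological.copy (XF R) (set_type (@x2x3_shift R)).

Definition XF_fun (R : realType) (w : XF R) : int * int -> R[i] := set_val w.
Coercion XF_fun : XF >-> Funclass.

Section XF_group.
Context {R : realType}.
Implicit Types u v w : XF R.

Lemma XF_ext u v : (forall z, u z = v z) -> u = v.
Proof. by move=> uv; apply/val_inj/funext => z; exact: uv. Qed.

Lemma XF_norm1 w z : `|w z| = 1.
Proof. by have [+ _] := set_valP w; exact. Qed.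

Lemma XF_shift w z : w (z + e1) = w z ^+ 2 /\ w (z + e2) = w z ^+ 3.
Proof. by have [_] := set_valP w; exact. Qed.

Lemma XF_one_subproof : @x2x3_shift R (fun=> 1).
Proof. by split=> z; [exact: normr1|rewrite !expr1n]. Qed.

Lemma XF_mul_subproof u v : @x2x3_shift R (fun z => u z * v z).
Proof.
split=> z; first by rewrite /circle/= normrM !XF_norm1 mulr1.
by have [-> ->] := XF_shift u z; have [-> ->] := XF_shift v z; rewrite !exprMn.
Qed.

Lemma XF_inv_subproof u : @x2x3_shift R (fun z => (u z)^-1).
Proof.
split=> z; first by rewrite /circle/= normfV XF_norm1 invr1.
by have [-> ->] := XF_shift u z; rewrite !exprVn.
Qed.

Definition XF_one : XF R := SigSub (mem_set XF_one_subproof).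
Definition XF_mul u v : XF R := SigSub (mem_set (XF_mul_subproof u v)).
Definition XF_inv u : XF R := SigSub (mem_set (XF_inv_subproof u)).

Lemma XF_mulA : associative XF_mul.
Proof. by move=> u v w; apply: XF_ext => z; exact: mulrA. Qed.

Lemma XF_mul1 : left_id XF_one XF_mul.
Proof. by move=> u; apply: XF_ext => z; exact: mul1r. Qed.

Lemma XF_mulr1 : right_id XF_one XF_mul.
Proof. by move=> u; apply: XF_ext => z; exact: mulr1. Qed.

Lemma XF_neq0 w z : w z != 0.
Proof. by rewrite -normr_eq0 XF_norm1 oner_eq0. Qed.

Lemma XF_mulV : left_inverse XF_one XF_inv XF_mul.
Proof. by move=> u; apply: XF_ext => z; exact: (mulVf (XF_neq0 u z)). Qed.

Lemma XF_mulrV : right_inverse XF_one XF_inv XF_mul.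
Proof. by move=> u; apply: XF_ext => z; exact: (mulfV (XF_neq0 u z)). Qed.

End XF_group.

HB.instance Definition _ (R : realType) := isGroup.Build (XF R)
  (@XF_mulA R) (@XF_mul1 R) (@XF_mulr1 R) (@XF_mulV R) (@XF_mulrV R).
HB.instance Definition _ (R : realType) := isPointed.Build (XF R) 1%g.

Definition XF_borel (R : realType) := g_sigma_algebraType (@open (XF R)).
HB.instance Definition _ (R : realType) := Measurable.on (XF_borel R).

(* The normalised Haar measure, characterised as the translation-invariant
   Borel probability measure: since [XF R] is a compact metrizable group there
   is exactly one such measure, and it is automatically regular. *)
Definition is_haar (R : realType) (mu : probability (XF_borel R) R) : Prop :=
  forall (g : XF R) (A : set (XF_borel R)), measurable A ->
    mu [set (g * x : XF R)%g | x in A] = mu A.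

Section correlation.
Context {R : realType}.

Definition box (N : nat) : set (int * int) :=
  [set x | - N%:Z <= x.1 <= N%:Z /\ - N%:Z <= x.2 <= N%:Z].

Lemma finite_box N : finite_set (box N).
Proof.
pose f (p : 'I_(N.*2.+1) * 'I_(N.*2.+1)) : int * int :=
  (p.1%:Z - N%:Z, p.2%:Z - N%:Z).
apply: (@sub_finite_set _ _ (f @` setT)); last exact/finite_image/finite_finset.
have H (a : int) : - N%:Z <= a <= N%:Z ->
    exists i : 'I_(N.*2.+1), i%:Z - N%:Z = a.
  move=> aN; have aN' : (`|(a + N%:Z)%R|%N < N.*2.+1)%N by lia.
  by exists (Ordinal aN') => /=; lia.
move=> [a b] [/= /H[i ia] /H[j jb]].
by exists (i, j) => //; rewrite /f /= ia jb.
Qed.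

Variables (w : XF R) (n : nat) (z : 'I_n -> int * int).

Definition corr_avg (m : 'I_n -> int) (N : nat) : R[i] :=
  (#|` fset_set (box N)|%:R)^-1 *
    \sum_(x \in box N) \prod_(j < n) w (x + z j) ^ m j.

(* [limn] takes a default value on divergent sequences: existence of the
   coefficient is [cvgn (corr_avg m)]. *)
Definition gen_corr (m : 'I_n -> int) : R[i] := limn (corr_avg m).

Definition gen_corr_exists (m : 'I_n -> int) : Prop := cvgn (corr_avg m).

Definition corr : R[i] := gen_corr (fun=> 1).

Definition corr_exists : Prop := gen_corr_exists (fun=> 1).

End correlation.

(* Main.v *)
Require Import Defs.
From HB Require Import structures.
From mathcomp Require Import all_boot all_order all_algebra finmap.
From mathcomp Require Import all_classical all_reals all_analysis.
From mathcomp Require Import measurable_realfun complex.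
From mathcomp Require Import zify ring lra.

(** Write [f_x w] for the product of the [w (x + z j) ^ m j], a character of
    the compact group [XF R], so that the correlation coefficient is the limit
    of the averages [A_N] of the [f_x] over the boxes.  To the data [z], [m]
    belongs the rational number [q = \sum_j m_j 2^k_j 3^l_j], called [degree]
    below, and translating the points by [x] multiplies it by [2^x.1 3^x.2].

    If [q = 0], every [f_x] is constantly [1]: all the coordinates involved are
    powers [w c ^ (2^a 3^b)] of one coordinate [w c] situated below and to the
    left of them, and [q] is, up to a nonzero factor, the total exponent
    ([monomial_degree0]).

    If [q != 0], no ergodic theorem is called for: the averages converge so
    fast in quadratic mean that almost sure convergence is immediate.  By unique
    factorisation the numbers [2^x.1 3^x.2 q] are pairwise distinct, so for
    [x != y] the character [f_x * conj f_y] is not trivial; it even takes the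
    value [-1] on the one-parameter subgroup [t |-> (exp (i t 2^z.1 3^z.2))_z] of
    [XF R].  Translating by such a point changes the sign of the character and
    preserves the Haar measure, hence the integral of the character vanishes
    ([integral_corr_kernel]).  Thus the [f_x] are orthonormal, the integral of
    [`|A_N| ^+ 2] is the inverse of the number of points of the box
    ([integral_avg_energy]), which is summable in [N].  By monotone convergence
    the series of the [`|A_N| ^+ 2] is finite almost everywhere, so its terms
    tend to [0] there ([corr_avg_cvg0]).

    Only real-valued integrals occur: the square of the modulus of a sum of
    complex numbers is the sum of the real parts of the products of one term
    and the conjugate of another. *)

Import Order.TTheory GRing.Theory Num.Theory.
Import numFieldNormedType.Exports.

Local Open Scope classical_set_scope.
Local Open Scope ring_scope.

Set Implicit Arguments.
Unset Strict Implicit.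
Unset Printing Implicit Defensive.

(** * Real and imaginary parts *)

Section complex_parts.
Context {R : realType}.

Lemma ReM (x y : R[i]) : complex.Re (x * y) =
  complex.Re x * complex.Re y - complex.Im x * complex.Im y.
Proof. by case: x y => [a b] [c d]. Qed.

Lemma ImM (x y : R[i]) : complex.Im (x * y) =
  complex.Re x * complex.Im y + complex.Im x * complex.Re y.
Proof. by case: x y => [a b] [c d]. Qed.

Lemma normc_ge_Im (x : R[i]) : (`|complex.Im x|%:C)%C <= `|x|.
Proof.
case: x => a b; rewrite normc_def lecR/=.
by rewrite -sqrtr_sqr ler_wsqrtr // lerDr sqr_ge0.
Qed.

Lemma Re_continuous : continuous (@complex.Re R : R[i] -> R).
Proof.
move=> x; apply/(@cvgrPdist_lt _ _ _ _ (nbhs_filter x)) => e e0.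
exists e%:C%C => [|y /= xy]; first by rewrite /= ltcR.
rewrite -ltcR; apply: le_lt_trans xy.
by rewrite -raddfB; exact: normc_ge_Re.
Qed.

Lemma Im_continuous : continuous (@complex.Im R : R[i] -> R).
Proof.
move=> x; apply/(@cvgrPdist_lt _ _ _ _ (nbhs_filter x)) => e e0.
exists e%:C%C => [|y /= xy]; first by rewrite /= ltcR.
rewrite -ltcR; apply: le_lt_trans xy.
by rewrite -raddfB; exact: normc_ge_Im.
Qed.

End complex_parts.

(** * Topology and measurability on the shift *)

Section XF_topology.
Context {R : realType}.

Lemma XF_coord_continuous (z : int * int) : continuous (fun w : XF R => w z).
Proof.
move=> w; apply: (@continuous_comp (XF R) {ptws int * int -> R[i]} R[i]
  (fun w : XF R => XF_fun w) (fun f => f z)).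
  exact: (@initial_continuous (XF R) {ptws int * int -> R[i]} (@set_val _ _)).
exact: (@proj_continuous _ (fun=> R[i]) z).
Qed.

Lemma continuous_to_XF {T : topologicalType} (f : T -> XF R) :
  (forall z, continuous (fun x => f x z)) -> continuous f.
Proof.
move=> fc; apply: (@continuous_comp_initial (XF R) T
  {ptws int * int -> R[i]} (@set_val _ _)) => x.
apply/cvg_sup => z U [B [/= [A oA <-] Ax] /filterS]; apply.
by apply: fc; exact: open_nbhs_nbhs.
Qed.

Lemma mulXF_continuous (g : XF R) :
  continuous (fun w : XF R => (g * w : XF R)%g).
Proof.
apply: continuous_to_XF => z w.
rewrite (_ : (fun x => _) = (fun x : XF R => g z * x z)) //.
apply: (@cvgM R[i] (XF R) (nbhs w) _ (fun=> g z) (fun x => x z)).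
  exact: cvg_cst.
exact: XF_coord_continuous.
Qed.

Lemma continuous_measurable_XF (f : XF R -> R) :
  continuous f -> measurable_fun setT (f : XF_borel R -> R).
Proof.
move=> fc; apply: (measurability _ (RGenOpens.measurableE R)).
move=> _ [_ [x [y ->]] <-]; rewrite setTI; apply: sub_sigma_algebra.
by apply: open_comp => // w _; exact: fc.
Qed.

Lemma continuous_measurable_XF_XF (f : XF R -> XF R) :
  continuous f -> measurable_fun setT (f : XF_borel R -> XF_borel R).
Proof.
move=> fc; apply: (@measurability _ _ (XF_borel R) (XF_borel R) setT f
  (@open (XF R))); first by [].
move=> _ [A oA <-]; rewrite setTI; apply: sub_sigma_algebra.
by apply: open_comp => // w _; exact: fc.
Qed.

(** Measurability into the complex plane, in the form in which it yields the
    measurability of real integrands. *)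
Definition cmeasurable (f : XF_borel R -> R[i]) :=
  measurable_fun setT (fun w => complex.Re (f w)) /\
  measurable_fun setT (fun w => complex.Im (f w)).

Lemma cmeasurable_coord z : cmeasurable (fun w : XF_borel R => (w : XF R) z).
Proof.
have zc := @XF_coord_continuous z.
split; apply: continuous_measurable_XF => w.
  exact: (@continuous_comp (XF R) R[i] R (fun w => XF_fun w z) (@complex.Re R)
    w (zc w) (@Re_continuous R _)).
exact: (@continuous_comp (XF R) R[i] R (fun w => XF_fun w z) (@complex.Im R)
  w (zc w) (@Im_continuous R _)).
Qed.

Lemma cmeasurable_cst c : cmeasurable (fun=> c).
Proof. by split; exact: measurable_cst. Qed.

Lemma cmeasurableM (f g : XF_borel R -> R[i]) :
  cmeasurable f -> cmeasurable g -> cmeasurable (fun w => f w * g w).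
Proof.
move=> [f1 f2] [g1 g2]; split.
  under eq_fun do rewrite ReM.
  by apply: measurable_funB; exact: measurable_funM.
under eq_fun do rewrite ImM.
by apply: measurable_funD; exact: measurable_funM.
Qed.

Lemma cmeasurable_conj (f : XF_borel R -> R[i]) :
  cmeasurable f -> cmeasurable (fun w => (f w)^*%C).
Proof.
move=> [f1 f2]; split.
  by rewrite (_ : (fun w => _) = fun w => complex.Re (f w)) //;
    apply/funext => w; case: (f w).
rewrite (_ : (fun w => _) = fun w => - complex.Im (f w)); last first.
  by apply/funext => w; case: (f w).
exact: measurable_funN.
Qed.

End XF_topology.

(** * The numbers 2^k 3^l *)

Definition weight (F : unitRingType) (z : int * int) : F := 2 ^ z.1 * 3 ^ z.2.

Section weight.
Variable F : numFieldType.
Implicit Types x y z : int * int.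

Lemma weightD x y : weight F (x + y) = weight F x * weight F y.
Proof. by rewrite /weight !expfzDr ?pnatr_eq0// mulrACA. Qed.

Lemma weight_neq0 x : weight F x != 0.
Proof. by rewrite mulf_neq0// expfz_neq0// pnatr_eq0. Qed.

Lemma weight_nat (i j : nat) : weight F (i%:Z, j%:Z) = (2 ^ i * 3 ^ j)%:R.
Proof. by rewrite natrM !natrX. Qed.

Lemma ratr_weight x : ratr (weight rat x) = weight F x.
Proof. by rewrite /weight rmorphM/= !fmorphXz/= !ratr_nat. Qed.

End weight.

(** Integral exponents are reduced to natural ones by moving the origin to a
    point [c] below and to the left of finitely many given points. *)
Lemma common_corner n (z : 'I_n -> int * int) :
  exists (c : int * int) (a b : 'I_n -> nat),
    forall j, z j = c + ((a j)%:Z, (b j)%:Z).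
Proof.
pose K := (\sum_(j < n) (`|(z j).1| + `|(z j).2|))%N.
exists (- K%:Z, - K%:Z), (fun j => `|(K%:Z + (z j).1)%R|%N),
  (fun j => `|(K%:Z + (z j).2)%R|%N) => j.
have : (`|(z j).1| + `|(z j).2| <= K)%N by rewrite /K (bigD1 j)//= leq_addr.
by case: (z j) => x y /= h; congr pair => /=; lia.
Qed.

(** Unique factorisation. *)
Lemma weight_inj (F : numFieldType) : injective (weight F).
Proof.
move=> x y xy.
have [c [a [b cab]]] := @common_corner 2 (fun j => if j == ord0 then x else y).
have := cab ord0; have := cab ord_max; rewrite /= => yE xE.
move: xy; rewrite xE yE !weightD => /(mulfI (weight_neq0 F c)).
rewrite !weight_nat => /eqP; rewrite eqr_nat => /eqP ab.
have lg p := congr1 (logn p) ab.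
have := lg 2; have := lg 3.
rewrite !lognM ?expn_gt0// !lognX.
rewrite (_ : logn 3 2 = 0)%N // (_ : logn 3 3 = 1)%N //.
rewrite (_ : logn 2 2 = 1)%N // (_ : logn 2 3 = 0)%N //.
by rewrite !muln0 !muln1 !addn0 !add0n => -> ->.
Qed.

(** * A one-parameter subgroup of the shift *)

Lemma XF_shift_nat {R : realType} (w : XF R) c (i j : nat) :
  w (c + (i%:Z, j%:Z)) = w c ^+ (2 ^ i * 3 ^ j).
Proof.
have shift2 k : w (c + (k%:Z, 0)) = w c ^+ (2 ^ k).
  elim: k => [|k IH]; first by rewrite addr0.
  rewrite expnSr exprM -IH -(XF_shift w _).1 -addrA; congr (XF_fun w (c + _)).
  by congr pair; rewrite /= ?addr0; lia.
elim: j => [|j IH]; first by rewrite shift2 muln1.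
rewrite expnSr mulnA exprM -IH -(XF_shift w _).2 -addrA.
by congr (XF_fun w (c + _)); congr pair; rewrite /= ?addr0; lia.
Qed.

Section one_parameter.
Context {R : realType}.
Implicit Types s t : R.

(** The exponential [exp (i t)]. *)
Definition cis t : R[i] := (cos t +i* sin t)%C.

Lemma norm_cis t : `|cis t| = 1.
Proof. by rewrite normc_def/= cos2Dsin2 sqrtr1. Qed.

Lemma cis0 : cis 0 = 1.
Proof. by rewrite /cis cos0 sin0. Qed.

Lemma cispi : cis pi = -1.
Proof.
by rewrite /cis cospi sinpi; apply/eqP; rewrite eq_complex /= oppr0 !eqxx.
Qed.

Lemma cisD s t : cis (s + t) = cis s * cis t.
Proof. by apply/eqP; rewrite eq_complex /= cosD sinD eqxx addrC eqxx. Qed.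

Lemma cisN t : cis (- t) = (cis t)^*%C.
Proof. by rewrite /cis cosN sinN. Qed.

Lemma cisMz t (m : int) : cis (m%:~R * t) = cis t ^ m.
Proof.
have cisMn k : cis (k%:R * t) = cis t ^+ k.
  elim: k => [|k IH]; first by rewrite mul0r cis0.
  by rewrite -addn1 natrD mulrDl mul1r cisD IH addn1 exprSr.
case: m => k; first exact: cisMn.
have n0 : cis (k.+1%:R * t) != 0 by rewrite -normr_eq0 norm_cis oner_eq0.
rewrite NegzE mulrNz mulNr -exprnN -cisMn; apply: (mulfI n0).
by rewrite mulfV// -cisD subrr cis0.
Qed.

Lemma one_parameter_subproof t : @x2x3_shift R (fun z => cis (t * weight R z)).
Proof.
split=> z; first exact: norm_cis.
rewrite !weightD /weight/= !expr1z !expr0z mulr1 mul1r.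
by split; [rewrite -[RHS]/(cis _ ^ 2%:Z)|rewrite -[RHS]/(cis _ ^ 3%:Z)];
  rewrite -cisMz; congr cis; ring.
Qed.

(** The shift contains enough explicit points to separate its characters: on
    these, a character is [t |-> exp (i t q)] with [q] its degree
    ([monomial_one_parameter]). *)
Definition one_parameter t : XF R := SigSub (mem_set (one_parameter_subproof t)).

End one_parameter.

(** * Characters of the shift *)

Definition monomial {R : realType} {n} (z : 'I_n -> int * int)
    (m : 'I_n -> int) (w : XF R) : R[i] :=
  \prod_(j < n) w (z j) ^ m j.

Definition degree {n} (z : 'I_n -> int * int) (m : 'I_n -> int) : rat :=
  \sum_(j < n) (m j)%:~R * weight rat (z j).

Lemma degree_translate {n} (z : 'I_n -> int * int) (m : 'I_n -> int) x :
  degree (fun j => x + z j) m = weight rat x * degree z m.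
Proof.
rewrite /degree mulr_sumr; apply: eq_bigr => j _.
by rewrite weightD mulrCA.
Qed.

Section monomial.
Context {R : realType} {n : nat} (z : 'I_n -> int * int) (m : 'I_n -> int).
Implicit Types (g w : XF R).

Lemma monomialM g w :
  monomial z m (g * w)%g = monomial z m g * monomial z m w.
Proof.
rewrite /monomial -big_split; apply: eq_bigr => j _ /=.
by rewrite -expfzMl.
Qed.

Lemma norm_monomial w : `|monomial z m w| = 1.
Proof.
rewrite /monomial normr_prod big1// => j _.
have n1 k : `|w (z j) ^+ k| = 1 by rewrite normrX XF_norm1 expr1n.
by case: (m j) => k; rewrite ?NegzE -?exprnN ?normfV n1 ?invr1.
Qed.

Lemma monomial_one_parameter (t : R) :
  monomial z m (one_parameter t) = cis (t * ratr (degree z m)).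
Proof.
rewrite /degree rmorph_sum mulr_sumr.
rewrite (big_morph _ (@cisD R) (@cis0 R)); apply: eq_bigr => j _.
by rewrite rmorphM/= ratr_int ratr_weight mulrCA cisMz.
Qed.

(** Every factor is a power of the coordinate at a common corner [c]; the
    total exponent is the degree divided by the weight of [c]. *)
Lemma monomial_degree0 w : degree z m = 0 -> monomial z m w = 1.
Proof.
have [c [a [b zE]]] := common_corner z.
move=> deg0.
have e0 : \sum_(j < n) m j * (2 ^ a j * 3 ^ b j)%N%:Z = 0.
  apply/eqP; rewrite -(intr_eq0 rat); apply/eqP.
  apply: (mulfI (weight_neq0 rat c)); rewrite mulr0 -[RHS]deg0.
  rewrite /degree rmorph_sum mulr_sumr; apply: eq_bigr => j _.
  by rewrite zE weightD weight_nat rmorphM mulrCA/=.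
rewrite -[RHS](expr0z (w c)) -e0 /monomial.
rewrite (big_morph _ (fun i j => expfzDr i j (XF_neq0 w c)) (expr0z (w c))).
apply: eq_bigr => j _.
by rewrite zE XF_shift_nat exprnP exprz_exp mulrC.
Qed.

End monomial.

Lemma cmeasurable_monomial {R : realType} n (z : 'I_n -> int * int)
    (m : 'I_n -> int) : cmeasurable (monomial z m : XF_borel R -> R[i]).
Proof.
have pw z0 k : cmeasurable (fun w : XF_borel R => (w : XF R) z0 ^+ k).
  elim: k => [|k IH]; first exact: cmeasurable_cst.
  under eq_fun do rewrite exprS.
  by apply: cmeasurableM IH; exact: cmeasurable_coord.
have pwz z0 k : cmeasurable (fun w : XF_borel R => (w : XF R) z0 ^ k).
  case: k => k; first exact: pw.
  (* On the unit circle the inverse is the conjugate. *)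
  rewrite (_ : (fun w => _) =
    fun w : XF_borel R => (((w : XF R) z0) ^+ k.+1)^*%C).
    exact: cmeasurable_conj.
  apply/funext => w; rewrite NegzE -exprnN.
  have n1 : `|(w : XF R) z0 ^+ k.+1| = 1 by rewrite normrX XF_norm1 expr1n.
  by rewrite invC_norm n1 expr1n invr1 mul1r.
rewrite /monomial; elim: n z m => [|n IH] z m.
  by under eq_fun do rewrite big_ord0; exact: cmeasurable_cst.
under eq_fun do rewrite big_ord_recl.
by apply: cmeasurableM; [exact: pwz|exact: IH].
Qed.

(** * Orthogonality for the Haar measure *)

Section haar.
Context {R : realType} (mu : probability (XF_borel R) R).

Lemma integrable_le1 (f : XF_borel R -> R) :
  measurable_fun setT f -> (forall w, `|f w| <= 1) ->
  mu.-integrable setT (EFin \o f).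
Proof.
move=> mf f1; apply: measurable_bounded_integrable => //.
  by rewrite (le_lt_trans (probability_le1 mu measurableT))// ltry.
by exists 1; split=> // M M1 w _ /=; exact: le_trans (f1 w) (ltW M1).
Qed.

Hypothesis mu_haar : is_haar mu.

Lemma integral_translate (g : XF R) (f : XF_borel R -> R) :
  measurable_fun setT f -> (forall w, `|f w| <= 1) ->
  (\int[mu]_w (f (g * w : XF R)%g)%:E = \int[mu]_w (f w)%:E)%E.
Proof.
move=> mf f1.
pose T : XF_borel R -> XF_borel R := fun w => (g * (w : XF R) : XF R)%g.
have mT : measurable_fun setT T.
  by apply: continuous_measurable_XF_XF; exact: mulXF_continuous.
have mfT : measurable_fun setT (f \o T) by exact: measurableT_comp.
transitivity (\int[pushforward mu T]_w (f w)%:E)%E.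
  rewrite (integral_pushforward mT)//; first exact/measurable_EFinP.
  by apply: (@integrable_le1 (f \o T)) => // w; exact: f1.
apply: eq_measure_integral => A mA _.
transitivity (mu [set (g^-1 * x : XF R)%g | x in A]); last exact: mu_haar.
rewrite /pushforward; congr (mu _).
apply/seteqP; split => w /=.
  by move=> TA; exists (T w) => //; rewrite /T mulKg.
by move=> [v Av <-]; rewrite /T mulVKg.
Qed.

Lemma integral_antiperiodic (g : XF R) (f : XF_borel R -> R) :
  measurable_fun setT f -> (forall w, `|f w| <= 1) ->
  (forall w : XF R, f (g * w)%g = - f w) ->
  (\int[mu]_w (f w)%:E = 0)%E.
Proof.
move=> mf f1 fg; have fi := integrable_le1 mf f1.
have := integral_translate g mf f1.
under eq_integral do rewrite fg -mulN1r EFinM.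
rewrite integralZl//.
have := integrable_fin_num measurableT fi; rewrite /comp.
case: (\int[mu]_x _)%E => // r _; rewrite -EFinM => -[rr].
by congr EFin; lra.
Qed.

Variables (n : nat) (z : 'I_n -> int * int) (m : 'I_n -> int).

Let f (x : int * int) (w : XF R) : R[i] := monomial (fun j => x + z j) m w.

Definition corr_kernel x y (w : XF R) := complex.Re (f x w * (f y w)^*%C).

Lemma measurable_corr_kernel x y :
  measurable_fun setT (corr_kernel x y : XF_borel R -> R).
Proof.
suff [] : cmeasurable (fun w : XF_borel R => f x w * (f y w)^*%C) by [].
apply: cmeasurableM; first exact: cmeasurable_monomial.
by apply: cmeasurable_conj; exact: cmeasurable_monomial.
Qed.

Lemma norm_corr_kernel x y w : `|corr_kernel x y w| <= 1.
Proof.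
rewrite -lecR; apply: le_trans (normc_ge_Re _) _.
by rewrite normrM normcJ !norm_monomial mulr1.
Qed.

(** For [x != y] the character [f x * conj (f y)] has the nonzero degree [d];
    it equals [exp (i pi) = -1] at the parameter [pi / d], and translation by
    that point changes its sign. *)
Lemma integral_corr_kernel (deg_neq0 : degree z m != 0) x y :
  (\int[mu]_w (corr_kernel x y w)%:E = (x == y)%:R%:E)%E.
Proof.
case: eqVneq => [->|xy].
  rewrite (eq_integral (cst 1%E)) => [|w _].
    by rewrite integral_cst// mul1e; exact: probability_setT.
  by rewrite /corr_kernel -normCK norm_monomial expr1n.
pose d : R := ratr ((weight rat x - weight rat y) * degree z m).
have d0 : d != 0.
  rewrite fmorph_eq0 mulf_neq0// subr_eq0.
  by apply: contra xy => /eqP/weight_inj ->.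
pose g := one_parameter (pi / d).
have fg : f x g * (f y g)^*%C = -1.
  rewrite /f !monomial_one_parameter !degree_translate.
  rewrite -cisN -cisD -cispi; congr cis.
  rewrite -mulrBr -rmorphB/= -mulrBl -/d.
  by rewrite mulfVK.
apply: (@integral_antiperiodic g) => [||w].
- exact: measurable_corr_kernel.
- exact: norm_corr_kernel.
- by rewrite /corr_kernel /f !monomialM rmorphM/= mulrACA fg mulN1r raddfN.
Qed.

End haar.

(** * Quadratic means of sums of translated characters *)

(** The square of the modulus of a sum of translates of a monomial, expanded
    into a double sum; as a real number it can be integrated. *)
Definition energy {R : realType} {n} (z : 'I_n -> int * int) m
    (s : seq (int * int)) (w : XF R) : R :=
  \sum_(x <- s) \sum_(y <- s) corr_kernel z m x y w.

Section energy.
Context {R : realType} {n : nat} (z : 'I_n -> int * int) (m : 'I_n -> int).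
Variable s : seq (int * int).

Lemma energyE (w : XF R) : ((energy z m s w)%:C)%C =
  `|\sum_(x <- s) monomial (fun j => x + z j) m w| ^+ 2.
Proof.
have conv (c : R[i]) : `|c| ^+ 2 = (complex.Re (c * c^*%C))%:C%C.
  have -> : c * c^*%C = `|c| ^+ 2 by rewrite normCK.
  by rewrite -add_Re2_Im2.
rewrite conv; congr (_%:C)%C; rewrite rmorph_sum/= mulr_suml raddf_sum/=.
apply: eq_bigr => x _; rewrite mulr_sumr raddf_sum/=.
by apply: eq_bigr.
Qed.

Lemma energy_ge0 (w : XF R) : 0 <= energy z m s w.
Proof. by rewrite -lecR energyE exprn_ge0. Qed.

Lemma measurable_energy :
  measurable_fun setT (energy z m s : XF_borel R -> R).
Proof.
apply: measurable_sum => x; apply: measurable_sum => y.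
exact: measurable_corr_kernel.
Qed.

(** Pythagoras for the orthonormal family of translates. *)
Lemma integral_energy (mu : probability (XF_borel R) R) :
  is_haar mu -> degree z m != 0 -> uniq s ->
  (\int[mu]_w (energy z m s w)%:E = (size s)%:R%:E)%E.
Proof.
move=> mu_haar deg0 us.
have ik x y :
    mu.-integrable setT (EFin \o (corr_kernel z m x y : XF_borel R -> R)).
  apply: integrable_le1; first exact: measurable_corr_kernel.
  exact: norm_corr_kernel.
under eq_integral do rewrite /energy -sumEFin.
rewrite integral_sum//; last first.
  move=> x; under eq_fun do rewrite -sumEFin.
  by apply: integrable_sum => // y _; exact: ik.
rewrite -sum1_size natr_sum -sumEFin big_seq [RHS]big_seq.
apply: eq_bigr => x xs.
under eq_integral do rewrite -sumEFin.
rewrite integral_sum//; last by move=> y; exact: ik.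
under eq_bigr do rewrite (integral_corr_kernel mu_haar deg0).
rewrite sumEFin (bigD1_seq x)//= eqxx big1 ?addr0// => y /negPf yx.
by rewrite eq_sym yx.
Qed.

End energy.

(** * Summability *)

(** The points with nonnegative coordinates are already numerous enough for
    the inverse of the cardinal to be summable. *)
Lemma box_card N : (N.+1 ^ 2 <= #|` fset_set (box N)|)%N.
Proof.
pose f (p : 'I_N.+1 * 'I_N.+1) : int * int := (p.1%:Z, p.2%:Z).
have fi : injective f by move=> [i j] [k l] [/val_inj -> /val_inj ->].
rewrite -[leqLHS]/(N.+1 * N.+1)%N -{1 2}(card_ord N.+1) -card_prod cardE.
rewrite -(size_map f); apply: uniq_leq_size.
  by rewrite map_inj_uniq// enum_uniq.
move=> _ /mapP[[i j] _ ->]; rewrite in_fset_set; last exact: finite_box.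
by rewrite inE /box /f/=; have := ltn_ord i; have := ltn_ord j; lia.
Qed.

Lemma box_card_gt0 N : (0 < #|` fset_set (box N)|)%N.
Proof. by apply: leq_trans (box_card N); rewrite expn_gt0. Qed.

(** By comparison with the telescoping series of the
    [1 / (i + 1) - 1 / (i + 2)]. *)
Lemma inv_square_sum (R : realFieldType) (k : nat) :
  \sum_(0 <= i < k) (i.+1 ^ 2)%:R^-1 <= 2 :> R.
Proof.
case: k => [|k]; first by rewrite big_geq.
suff : \sum_(0 <= i < k.+1) (i.+1 ^ 2)%:R^-1 <= 2 - k.+1%:R^-1 :> R.
  by move=> /le_trans; apply; rewrite gerBl.
elim: k => [|k IH]; first by rewrite big_nat1; lra.
rewrite big_nat_recr//=; apply: le_trans (lerD IH (lexx _)) _.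
rewrite natrX -[k.+2]addn1 natrD; set a : R := k.+1%:R.
have a0 : 0 < a by rewrite ltr0n.
rewrite -subr_ge0 (_ : _ - _ = (a * (a + 1) ^+ 2)^-1).
  by rewrite invr_ge0 mulr_ge0 ?sqr_ge0// ltW.
by field; rewrite !gt_eqF// ltr_wpDr.
Qed.

Lemma cvg0_of_summable (R : realType) (u : nat -> R) : (forall k, 0 <= u k) ->
  (\sum_(0 <= k <oo) (u k)%:E < +oo)%E -> u @ \oo --> 0.
Proof.
move=> u0 us; apply: cvg_series_cvg_0; apply: nondecreasing_is_cvgn.
  by apply/nondecreasing_seqP => k; rewrite /series/= big_nat_recr//= lerDl.
have sfin : (\sum_(0 <= k <oo) (u k)%:E \is a fin_num)%E.
  by rewrite ge0_fin_numE// nneseries_ge0// => k _ _; rewrite lee_fin.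
exists (fine (\sum_(0 <= k <oo) (u k)%:E)%E) => _ [k _ <-].
rewrite -lee_fin fineK// /series/= -sumEFin.
by apply: nneseries_lim_ge => i _ _; rewrite lee_fin.
Qed.

(** * Almost sure convergence of the averages *)

Section averages.
Context {R : realType} {n : nat} {z : 'I_n -> int * int} {m : 'I_n -> int}.

Lemma corr_avgE (w : XF R) N : corr_avg w z m N =
  (#|` fset_set (box N)|%:R)^-1 *
    \sum_(x <- fset_set (box N)) monomial (fun j => x + z j) m w.
Proof. by rewrite /corr_avg fsbig_finite//; exact: finite_box. Qed.

Definition avg_energy N (w : XF_borel R) : R :=
  (#|` fset_set (box N)|%:R ^+ 2)^-1 * energy z m (fset_set (box N)) w.

Lemma avg_energyE N (w : XF R) :
  ((avg_energy N w)%:C)%C = `|corr_avg w z m N| ^+ 2.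
Proof.
rewrite corr_avgE normrM exprMn -energyE rmorphM/= normfV normr_nat.
by rewrite fmorphV rmorphXn/= rmorph_nat exprVn.
Qed.

Lemma avg_energy_ge0 N w : 0 <= avg_energy N w.
Proof. by rewrite mulr_ge0// ?energy_ge0// invr_ge0 exprn_ge0. Qed.

Lemma measurable_avg_energy N : measurable_fun setT (avg_energy N).
Proof. by apply: measurable_funM => //; exact: measurable_energy. Qed.

Context {mu : probability (XF_borel R) R} (mu_haar : is_haar mu).

Lemma integral_avg_energy N : degree z m != 0 ->
  (\int[mu]_w (avg_energy N w)%:E = (#|` fset_set (box N)|%:R^-1)%:E)%E.
Proof.
move=> deg0; under eq_integral do rewrite /avg_energy EFinM.
rewrite ge0_integralZl//.
- rewrite (integral_energy mu_haar) ?fset_uniq//.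
  rewrite -EFinM -[size _]/(#|` _|) expr2 invfM mulfVK//.
  by rewrite pnatr_eq0 -lt0n box_card_gt0.
- by apply/measurable_EFinP; exact: measurable_energy.
- by move=> w _; rewrite lee_fin energy_ge0.
Qed.

(** The series of the squares of the moduli has a finite integral, so it
    converges almost everywhere and its terms tend to zero. *)
Lemma corr_avg_cvg0 : degree z m != 0 ->
  {ae mu, forall w : XF R, corr_avg w z m @ \oo --> (0 : R[i])}.
Proof.
move=> deg0.
have mE N : measurable_fun setT (EFin \o avg_energy N).
  by apply/measurable_EFinP; exact: measurable_avg_energy.
have Ege0 N w : (0 <= (avg_energy N w)%:E)%E by rewrite lee_fin avg_energy_ge0.
have int_lt : (\int[mu]_w \sum_(0 <= N <oo) (avg_energy N w)%:E < +oo)%E.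
  rewrite integral_nneseries//.
  apply: (@le_lt_trans _ _ 2%:E); last exact: ltry.
  apply: lime_le.
    by apply: is_cvg_nneseries => N _ _; apply: integral_ge0 => w _.
  apply: nearW => k; under eq_bigr do rewrite integral_avg_energy//.
  rewrite sumEFin lee_fin; apply: le_trans (inv_square_sum R k).
  apply: ler_sum => N _.
  by rewrite lef_pV2 ?ler_nat ?box_card// posrE ltr0n ?expn_gt0// box_card_gt0.
have sum_int : mu.-integrable setT
    (fun w => \sum_(0 <= N <oo) (avg_energy N w)%:E)%E.
  apply/integrableP; split.
    move=> mT; apply: (@ge0_emeasurable_sum _ _ _ setT
      (fun N w => (avg_energy N w)%:E) predT) => // k _.
    exact: mE.
  under eq_integral do rewrite gee0_abs ?nneseries_ge0//.
  exact: int_lt.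
apply: filterS (integrable_ae measurableT sum_int) => w /(_ I) wfin.
have {wfin} : (\sum_(0 <= N <oo) (avg_energy N w)%:E < +oo)%E.
  by rewrite -ge0_fin_numE// nneseries_ge0.
move=> /(cvg0_of_summable (fun N => avg_energy_ge0 N w)) /cvgr0Pnorm_lt E0.
(* A positive complex number is a positive real number. *)
apply/(@cvgr0Pnorm_lt R[i] R[i]) => -[e e'] /[dup] e0.
rewrite ltcE/= => /andP[/eqP ? egt0]; subst e'.
near=> N.
rewrite -(@ltr_pXn2r _ 2)// ?nnegrE//; last exact: ltW.
rewrite -avg_energyE.
have -> : (e +i* 0)%C ^+ 2 = ((e ^+ 2)%:C)%C by rewrite rmorphXn.
rewrite ltcR -[ltLHS]ger0_norm ?avg_energy_ge0//.
by near: N; apply: E0; rewrite exprn_gt0.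
Unshelve. all: by end_near. Qed.

End averages.

Lemma ae_gen_corr {R : realType} {mu : probability (XF_borel R) R}
    (mu_haar : is_haar mu) {n : nat} (z : 'I_n -> int * int)
    (m : 'I_n -> int) :
  {ae mu, forall w : XF R, gen_corr_exists w z m /\
      gen_corr w z m = if degree z m == 0 then 1 else 0}.
Proof.
have lim (w : XF R) c : corr_avg w z m @ \oo --> (c : R[i]) ->
    gen_corr_exists w z m /\ gen_corr w z m = c.
  move=> wc; split; first by apply/cvg_ex; exists c.
  by apply/cvg_lim => //; exact: norm_hausdorff.
have [deg0|deg0] := eqVneq (degree z m) 0; last first.
  have := corr_avg_cvg0 mu_haar deg0.
  by apply: (@filterS _ (almost_everywhere mu)) => w; exact: lim.
apply: aeW => w; apply: lim.
rewrite (_ : corr_avg w z m = cst 1); first exact: cvg_cst.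
apply/funext => N; rewrite corr_avgE.
under eq_bigr do rewrite monomial_degree0 ?degree_translate ?deg0 ?mulr0//.
rewrite big_const_seq count_predT iter_addr_0 -[size _]/(#|` _|) mulVf//.
by rewrite pnatr_eq0 -lt0n box_card_gt0.
Qed.

Theorem theorem8 (R : realType) (mu : probability (XF_borel R) R)
    (mu_haar : is_haar mu) (n : nat) (n_gt0 : (0 < n)%N)
    (z : 'I_n -> int * int) :
  {ae mu, forall w : XF R, corr_exists w z /\ corr w z = 0} /\
  (forall m : 'I_n -> int,
    {ae mu, forall w : XF R, gen_corr_exists w z m /\
      gen_corr w z m =
        if \sum_(j < n) (m j)%:~R * 2 ^ (z j).1 * 3 ^ (z j).2 == 0 :> rat
        then 1 else 0}).
Proof.
have degE (m : 'I_n -> int) :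
    degree z m = \sum_(j < n) (m j)%:~R * 2 ^ (z j).1 * 3 ^ (z j).2.
  by apply: eq_bigr => j _; rewrite /weight mulrA.
split=> [|m]; last by rewrite -degE; exact: ae_gen_corr.
(* A nonempty sum of positive weights is not zero. *)
have deg_gt0 : 0 < degree z (fun=> 1).
  case: n n_gt0 z {degE} => // k _ z.
  rewrite /degree big_ord_recl ltr_wpDr ?sumr_ge0// => [j _|].
    by rewrite mul1r mulr_ge0// exprz_ge0.
  by rewrite mul1r mulr_gt0// exprz_gt0.
by have := ae_gen_corr mu_haar z (fun=> 1); rewrite gt_eqF.
Qed.
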